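(* For a $G$-coalgebra $\underline{C}$, the following conditions are equivalent: (1) $\underline{C}$ is cocleft; (2) $\underline{C}$ is isomorphic (as a $G$-coalgebra) to a crossed coproduct $G$-coalgebra $C\rtimes_f k\langle G\rangle$; (3) $\underline{C}$ is isomorphic to a crossed coproduct $G$-coalgebra $C\rtimes_f k\langle G\rangle$, with $f$ normalized; (4) $\underline{C}$ is a strong $G$-coalgebra, and every $C_\alpha$ is isomorphic to $C_e$ as a left $C_e$-comodule.
   Context: $k$ is a field, $\otimes=\otimes_k$, $G$ is a group with identity $e$; the identity map of an object $X$ is denoted $X$. A $G$-coalgebra (group coalgebra) $\underline{C}=(C_\alpha)_{\alpha\in G}$ is a family of $k$-vector spaces with $k$-linear maps $\Delta_{\alpha,\beta}:C_{\alpha\beta}\to C_\alpha\otimes C_\beta$ and $\varepsilon:C_e\to k$ such that $(\Delta_{\alpha,\beta}\otimes C_\gamma)\circ\Delta_{\alpha\beta,\gamma}=(C_\alpha\otimes\Delta_{\beta,\gamma})\circ\Delta_{\alpha,\beta\gamma}$ and $(C_\alpha\otimes\varepsilon)\circ\Delta_{\alpha,e}=C_\alpha=(\varepsilon\otimes C_\alpha)\circ\Delta_{e,\alpha}$. Write $\Delta_{\alpha,\beta}(c)=c_{(1,\alpha)}\otimes c_{(2,\beta)}$. $C_e$ is a coalgebra and $C_\alpha$ is a left $C_e$-comodule via $\Delta_{e,\alpha}$. A morphism $\underline{C}\to\underline{D}$ of $G$-coalgebras is a family of $k$-linear maps $\varphi_\alpha:C_\alpha\to D_\alpha$ with $\varepsilon_{\underline{D}}\circ\varphi_e=\varepsilon_{\underline{C}}$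 and $(\varphi_\alpha\otimes\varphi_\beta)\circ\Delta^{\underline{C}}_{\alpha,\beta}=\Delta^{\underline{D}}_{\alpha,\beta}\circ\varphi_{\alpha\beta}$. $\underline{C}$ is strong if all $\Delta_{\alpha,\beta}$ are monomorphisms. $k\langle G\rangle$ is the $G$-coalgebra with $k\langle G\rangle_\sigma=kp_\sigma$ (one-dimensional), $\Delta_{\sigma,\tau}(p_{\sigma\tau})=p_\sigma\otimes p_\tau$, $\varepsilon(p_e)=1$. Cocleft: a family of $k$-linear maps $\underline{u}:\underline{C}\to k\langle G\rangle$, i.e. a family $u_\alpha\in C_\alpha^*$ (sending $c\in C_\alpha$ to $u_\alpha(c)p_\alpha$), is convolution invertible if there are $v_\alpha\in C_{\alpha^{-1}}^*$ ($\alpha\in G$) with $u_\alpha(c_{(1,\alpha)})v_\alpha(c_{(2,\alpha^{-1})})=v_\alpha(c_{(1,\alpha^{-1})})u_\alpha(c_{(2,\alpha)})=\varepsilon(c)$ for all $c\in C_e$. $\underline{C}$ is cocleft (over $C_e$) if a convolution invertible $\underline{u}$ exists. Crossed coproducts: let $C$ be a coalgebra. A weak $G$-action on $C$ is a family $\lambda=(\lambda_\alpha)_{\alpha\in G}$ of coalgebra maps $\lambda_\alpha:C\to C$. Let $f=(f_{\alpha,\beta})_{\alpha,\beta\in G}$ be a family in $C^*$. $f$ is a factor set (for $\lambda$) if every $f_{\alpha,\beta}$ has a convolution inverse $g_{\alpha,\beta}$ in $C^*$, and for all $c\in C$ and $\alpha,\beta,\gamma\in G$: $\lambda_e(c)=f_{e,e}(c_{(1)})c_{(2)}g_{e,e}(c_{(3)})$;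 $f_{e,\alpha}=f_{e,e}$; $f_{\alpha,e}=f_{e,e}\circ\lambda_\alpha$; $f_{\beta,\gamma}(\lambda_\alpha(c_{(1)}))f_{\alpha,\beta\gamma}(c_{(2)})=f_{\alpha,\beta}(c_{(1)})f_{\alpha\beta,\gamma}(c_{(2)})$; $(\lambda_\beta\circ\lambda_\alpha)(c_{(1)})f_{\alpha,\beta}(c_{(2)})=f_{\alpha,\beta}(c_{(1)})\lambda_{\alpha\beta}(c_{(2)})$. Then the crossed coproduct $G$-coalgebra $C\rtimes_f k\langle G\rangle=(C\rtimes p_\alpha)_{\alpha\in G}$ (each $C\rtimes p_\alpha$ a copy of $C$) has structure maps $\Delta_{\alpha,\beta}(c\rtimes p_{\alpha\beta})=(c_{(1)}\rtimes p_\alpha)\otimes(\lambda_\alpha(c_{(2)})f_{\alpha,\beta}(c_{(3)})\rtimes p_\beta)$ and $\varepsilon(c\rtimes p_e)=g_{e,e}(c)$. $f$ is normalized if $f_{\alpha,e}=f_{e,\alpha}=\varepsilon_C$ for all $\alpha\in G$. In (2) and (3), ''a crossed coproduct'' means for some coalgebra $C$, weak action $\lambda$ and factor set $f$. *)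

(* Defs.v *)
From HB Require Import structures.
From mathcomp Require Import all_boot all_order all_algebra.
From mathcomp Require Import boolp.

Set Implicit Arguments.
Unset Strict Implicit.
Unset Printing Implicit Defensive.

Import GRing.Theory.
Local Open Scope ring_scope.
Local Open Scope quotient_scope.

(** [tens U V] is the quotient of the monoid of formal sums of pairs
    [(u, v)] (encoded as sequences) by the congruence generated by
    commutativity and the bilinearity relations.  The lemmas [tens_ind] and
    [sweedlerE], [sweedler_linear] express its universal property. *)

Section TensorProduct.

Variables (k : fieldType) (U V : lmodType k).

Inductive tens_eqv : seq (U * V) -> seq (U * V) -> Prop :=
| TensRefl s : tens_eqv s s
| TensSym s t : tens_eqv s t -> tens_eqv t s
| TensTrans s t r : tens_eqv s t -> tens_eqv t r -> tens_eqv s r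
| TensCat s s' t t' :
    tens_eqv s s' -> tens_eqv t t' -> tens_eqv (s ++ t) (s' ++ t')
| TensComm s t : tens_eqv (s ++ t) (t ++ s)
| TensZero v : tens_eqv [:: (0, v)] [::]
| TensDl u u' v : tens_eqv [:: (u + u', v)] [:: (u, v); (u', v)]
| TensDr u v v' : tens_eqv [:: (u, v + v')] [:: (u, v); (u, v')]
| TensZ a u v : tens_eqv [:: (a *: u, v)] [:: (u, a *: v)].

Definition tens_eqb (s t : seq (U * V)) : bool := `[< tens_eqv s t >].

Lemma tens_eqb_refl : reflexive tens_eqb.
Proof. by move=> s; apply/asboolP; exact: TensRefl. Qed.

Lemma tens_eqb_sym : symmetric tens_eqb.
Proof. by move=> s t; apply/asboolP/asboolP; exact: TensSym. Qed.

Lemma tens_eqb_trans : transitive tens_eqb.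
Proof.
by move=> t s r /asboolP st /asboolP tr; apply/asboolP; exact: TensTrans st tr.
Qed.

Canonical tens_equiv := EquivRel tens_eqb tens_eqb_refl tens_eqb_sym tens_eqb_trans.

Definition tens := {eq_quot tens_equiv}.

HB.instance Definition _ := Choice.on tens.
HB.instance Definition _ := EqQuotient.on tens.

Lemma tens_piP (s t : seq (U * V)) : tens_eqv s t <-> \pi_tens s = \pi_tens t.
Proof.
split=> [st|/eqP]; first by apply/eqP; rewrite eqmodE; apply/asboolP.
by rewrite eqmodE => /asboolP.
Qed.

Lemma tens_repr (s : seq (U * V)) : tens_eqv (repr (\pi_tens s)) s.
Proof. by apply/tens_piP; rewrite reprK. Qed.

Lemma tens_piE (x : tens) : \pi_tens (repr x) = x.
Proof. exact: reprK. Qed.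

Definition tens_add (x y : tens) : tens := \pi_tens (repr x ++ repr y).
Definition tens_scale (a : k) (x : tens) : tens :=
  \pi_tens [seq (a *: p.1, p.2) | p <- repr x].

Lemma tens_add_pi s t : tens_add (\pi_tens s) (\pi_tens t) = \pi_tens (s ++ t).
Proof. by apply/tens_piP; apply: TensCat; exact: tens_repr. Qed.

Lemma tens_eqv_scale a (s t : seq (U * V)) : tens_eqv s t ->
  tens_eqv [seq (a *: p.1, p.2) | p <- s] [seq (a *: p.1, p.2) | p <- t].
Proof.
elim=> {s t} /=.
- by move=> s; exact: TensRefl.
- by move=> s t _; exact: TensSym.
- by move=> s t r _ st _; exact: TensTrans.
- by move=> s s' t t' _ ss _ tt; rewrite !map_cat; exact: TensCat.
- by move=> s t; rewrite !map_cat; exact: TensComm.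
- by move=> v; rewrite scaler0; exact: TensZero.
- by move=> u u' v; rewrite scalerDr; exact: TensDl.
- by move=> u v v'; exact: TensDr.
- by move=> b u v; rewrite scalerA mulrC -scalerA; exact: TensZ.
Qed.

Lemma tens_scale_pi a s :
  tens_scale a (\pi_tens s) = \pi_tens [seq (a *: p.1, p.2) | p <- s].
Proof. by apply/tens_piP; apply: tens_eqv_scale; exact: tens_repr. Qed.

Lemma tens_addC : commutative tens_add.
Proof. by move=> x y; apply/tens_piP; exact: TensComm. Qed.

Lemma tens_addA : associative tens_add.
Proof.
move=> x y z; rewrite -[x]tens_piE -[y]tens_piE -[z]tens_piE !tens_add_pi.
by rewrite catA.
Qed.

Lemma tens_add0 : left_id (\pi_tens [::]) tens_add.
Proof. by move=> x; rewrite -[x]tens_piE tens_add_pi. Qed.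

Lemma tens_addN : left_inverse (\pi_tens [::]) (tens_scale (-1)) tens_add.
Proof.
move=> x; rewrite -[x]tens_piE tens_scale_pi tens_add_pi; apply/tens_piP.
elim: (repr x) => [|[u v] s IHs] /=; first exact: TensRefl.
set s' := map _ s in IHs *.
apply: (@TensTrans _ (([:: (-1 *: u, v)] ++ [:: (u, v)]) ++ (s' ++ s))).
  rewrite -catA -cat1s; apply: TensCat; first exact: TensRefl.
  rewrite -(cat1s (u, v) s) !catA; apply: TensCat; last exact: TensRefl.
  exact: TensComm.
apply: (TensTrans (TensCat _ IHs)); first last.
  rewrite cats0; apply: (TensTrans _ (TensZero v)).
  by apply: TensSym; rewrite -[X in (X, v)](addNr u) -scaleN1r; exact: TensDl.
exact: TensRefl.
Qed.

HB.instance Definition _ :=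
  GRing.isZmodule.Build tens tens_addA tens_addC tens_add0 tens_addN.

Lemma tens_piD s t : \pi_tens s + \pi_tens t = \pi_tens (s ++ t).
Proof. exact: tens_add_pi. Qed.

Lemma tens_scaleA a b x : tens_scale a (tens_scale b x) = tens_scale (a * b) x.
Proof.
rewrite -[x]tens_piE !tens_scale_pi -map_comp; congr (\pi_tens _).
by apply: eq_map => p /=; rewrite scalerA.
Qed.

Lemma tens_scale1 : left_id 1 tens_scale.
Proof.
move=> x; rewrite -[x]tens_piE tens_scale_pi; congr (\pi_tens _).
by rewrite -[RHS]map_id; apply: eq_map => -[u v] /=; rewrite scale1r.
Qed.

Lemma tens_scaleDr : right_distributive tens_scale +%R.
Proof.
move=> a x y; rewrite -[x]tens_piE -[y]tens_piE tens_piD !tens_scale_pi.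
by rewrite tens_piD map_cat.
Qed.

Lemma tens_scaleDl x : {morph tens_scale^~ x : a b / a + b}.
Proof.
move=> a b; rewrite -[x]tens_piE !tens_scale_pi [RHS]tens_piD; apply/tens_piP.
elim: (repr x) => [|[u v] s IHs] /=; first exact: TensRefl.
set t := map _ s in IHs *; set ta := map _ s in IHs *.
set tb := map _ s in IHs *.
apply: (@TensTrans _ (([:: (a *: u, v)] ++ [:: (b *: u, v)]) ++ (ta ++ tb))).
  rewrite -cat1s; apply: TensCat IHs; rewrite scalerDl; exact: TensDl.
rewrite -catA -[X in tens_eqv _ X]cat1s; apply: TensCat; first exact: TensRefl.
rewrite -(cat1s (b *: u, v) tb) !catA; apply: TensCat; last exact: TensRefl.
exact: TensComm.
Qed.

HB.instance Definition _ := GRing.Zmodule_isLmodule.Build k tens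
  tens_scaleA tens_scale1 tens_scaleDr tens_scaleDl.

Definition tprod (u : U) (v : V) : tens := \pi_tens [:: (u, v)].

Lemma tprodDl v : {morph tprod^~ v : u u' / u + u'}.
Proof. by move=> u u'; rewrite [RHS]tens_piD; apply/tens_piP; exact: TensDl. Qed.

Lemma tprodDr u : {morph tprod u : v v' / v + v'}.
Proof. by move=> v v'; rewrite [RHS]tens_piD; apply/tens_piP; exact: TensDr. Qed.

Lemma tprodZl a u v : tprod (a *: u) v = a *: tprod u v.
Proof. by rewrite [RHS]tens_scale_pi. Qed.

Lemma tprodZr a u v : tprod u (a *: v) = a *: tprod u v.
Proof. by rewrite -tprodZl; apply/tens_piP; apply: TensSym; exact: TensZ. Qed.

Lemma tens_sum (t : tens) : t = \sum_(p <- repr t) tprod p.1 p.2.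
Proof.
rewrite -[LHS]tens_piE; elim: (repr t) => [|[u v] s IHs]; first by rewrite big_nil.
by rewrite big_cons -IHs [RHS]tens_piD.
Qed.

Lemma tens_ind (P : tens -> Prop) :
  P 0 -> (forall x y, P x -> P y -> P (x + y)) ->
  (forall u v, P (tprod u v)) -> forall t, P t.
Proof. by move=> P0 PD Pt t; rewrite (tens_sum t); apply: big_ind. Qed.

(** Sweedler notation: [sweedler t F] is the sum of the [F u_i v_i] for a
    representation of [t] as a sum of the pure tensors [tprod u_i v_i].  It
    does not depend on the representation as soon as [F] is bilinear. *)

Definition sweedler (W : nmodType) (t : tens) (F : U -> V -> W) : W :=
  \sum_(p <- repr t) F p.1 p.2.

Definition bilin (W : lmodType k) (F : U -> V -> W) : Prop :=
  (forall v, linear (F^~ v)) /\ (forall u, linear (F u)).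

Section Bilinear.

Variables (W : lmodType k) (F : U -> V -> W).
Hypothesis bF : bilin F.

Lemma bilinDl u u' v : F (u + u') v = F u v + F u' v.
Proof. by have := bF.1 v 1 u u'; rewrite !scale1r. Qed.
Lemma bilinDr u v v' : F u (v + v') = F u v + F u v'.
Proof. by have := bF.2 u 1 v v'; rewrite !scale1r. Qed.
Lemma bilin0l v : F 0 v = 0.
Proof. by apply: (addIr (F 0 v)); rewrite -bilinDl !add0r. Qed.
Lemma bilin0r u : F u 0 = 0.
Proof. by apply: (addIr (F u 0)); rewrite -bilinDr !add0r. Qed.
Lemma bilinZl a u v : F (a *: u) v = a *: F u v.
Proof. by have := bF.1 v a u 0; rewrite bilin0l !addr0. Qed.
Lemma bilinZr a u v : F u (a *: v) = a *: F u v.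
Proof. by have := bF.2 u a v 0; rewrite bilin0r !addr0. Qed.

Lemma sweedler_eqv s t : tens_eqv s t ->
  \sum_(p <- s) F p.1 p.2 = \sum_(p <- t) F p.1 p.2.
Proof.
elim=> {s t} //.
- by move=> s t r _ -> _ ->.
- by move=> s s' t t' _ ss _ tt; rewrite !big_cat /= ss tt.
- by move=> s t; rewrite !big_cat /= addrC.
- by move=> v; rewrite big_seq1 big_nil bilin0l.
- by move=> u u' v; rewrite !(big_cons, big_nil) !addr0 /= bilinDl.
- by move=> u v v'; rewrite !(big_cons, big_nil) !addr0 /= bilinDr.
- by move=> a u v; rewrite !big_seq1 /= bilinZl bilinZr.
Qed.

Lemma sweedlerE u v : sweedler (tprod u v) F = F u v.
Proof. by rewrite /sweedler (sweedler_eqv (tens_repr _)) big_seq1. Qed.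

Lemma sweedler_linear : linear (fun t => sweedler t F).
Proof.
move=> a x y; rewrite -[x]tens_piE -[y]tens_piE [a *: _]tens_scale_pi.
rewrite [_ + _]tens_piD /sweedler !(sweedler_eqv (tens_repr _)).
rewrite big_cat big_map scaler_sumr /=; congr (_ + _).
by apply: eq_bigr => p _; rewrite bilinZl.
Qed.

End Bilinear.
End TensorProduct.

Notation "u \ot v" := (tprod u v) (at level 45, left associativity) : ring_scope.

Section TensorMaps.

Variable k : fieldType.

Lemma tprod_bilin (U V : lmodType k) : bilin (@tprod k U V).
Proof.
by split=> [v a u u' | u a v v'];
   rewrite ?tprodDl ?tprodDr ?tprodZl ?tprodZr.
Qed.

Lemma tens_linear_ext (U V W : lmodType k) (f g : {linear tens U V -> W}) :
  (forall u v, f (u \ot v) = g (u \ot v)) -> f =1 g.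
Proof.
by move=> fg; apply: tens_ind; rewrite ?linear0 // => x y; rewrite !linearD => -> ->.
Qed.

Section Map.
Variables (U U' V V' : lmodType k).
Variables (f : {linear U -> U'}) (g : {linear V -> V'}).

Definition tmap (t : tens U V) : tens U' V' :=
  sweedler t (fun u v => f u \ot g v).

Lemma tmap_bilin : bilin (fun u v => f u \ot g v).
Proof.
by split=> [v a u u' | u a v v'];
   rewrite linearP ?tprodDl ?tprodDr ?tprodZl ?tprodZr.
Qed.

HB.instance Definition _ := GRing.isLinear.Build k (tens U V) (tens U' V') _
  tmap (sweedler_linear tmap_bilin).

Lemma tmapE u v : tmap (u \ot v) = f u \ot g v.
Proof. exact: (sweedlerE tmap_bilin). Qed.
End Map.

Section Assoc.
Variables (U V W : lmodType k).

Definition tassoc (t : tens (tens U V) W) : tens U (tens V W) :=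
  sweedler t (fun x w => sweedler x (fun u v => u \ot (v \ot w))).

Lemma tassoc_bilin_in w : bilin (fun (u : U) (v : V) => u \ot (v \ot w : tens V W)).
Proof.
by split=> [v a u u' | u a v v'];
   rewrite ?tprodDl ?tprodDr ?tprodZl ?tprodZr.
Qed.

Lemma tassoc_bilin :
  bilin (fun (x : tens U V) (w : W) => sweedler x (fun u v => u \ot (v \ot w))).
Proof.
split=> [w a x x' | x a w w']; first exact: (sweedler_linear (tassoc_bilin_in w)).
rewrite /sweedler scaler_sumr -big_split /=.
by apply: eq_bigr => p _; rewrite !tprodDr !tprodZr.
Qed.

HB.instance Definition _ := GRing.isLinear.Build k (tens (tens U V) W)
  (tens U (tens V W)) _ tassoc (sweedler_linear tassoc_bilin).

Lemma tassocE u v w : tassoc ((u \ot v) \ot w) = u \ot (v \ot w).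
Proof.
by rewrite /tassoc (sweedlerE tassoc_bilin) (sweedlerE (tassoc_bilin_in w)).
Qed.
End Assoc.

End TensorMaps.

Ltac bilin_tac :=
  let a := fresh "a" in split; intros ? a ? ?;
  rewrite /= ?linearP /= ?linearP /= ?linearP /=
    ?(tprodDl, tprodDr, tprodZl, tprodZr, mulrDl, mulrDr, scalerDl, scalerDr);
  rewrite ?(tprodDl, tprodDr, tprodZl, tprodZr) ?scalerA -?mulrA
    ?(mulrCA _ a) ?(mulrC _ a) -?mulrA //.

Ltac lin_tac :=
  let a := fresh "a" in intros ? ? a ? ?;
  rewrite /= ?linearP /= ?linearP /= ?linearP /=
    ?(tprodDl, tprodDr, tprodZl, tprodZr, mulrDl, mulrDr, scalerDl, scalerDr);
  rewrite ?(tprodDl, tprodDr, tprodZl, tprodZr) ?scalerA -?mulrA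
    ?(mulrCA _ a) ?(mulrC _ a) -?mulrA //.

Section SweedlerTheory.
Variables (k : fieldType) (U V : lmodType k).

HB.instance Definition _ (u : U) := GRing.isLinear.Build k V (tens U V) _
  (tprod u) ((tprod_bilin U V).2 u).

Lemma eq_sweedler (W : nmodType) (F F' : U -> V -> W) (t : tens U V) :
  (forall u v, F u v = F' u v) -> sweedler t F = sweedler t F'.
Proof. by move=> FF; apply: eq_bigr => p _; exact: FF. Qed.

Lemma sweedler_linmap (W W' : lmodType k) (L : {linear W -> W'})
    (F : U -> V -> W) (t : tens U V) :
  L (sweedler t F) = sweedler t (fun u v => L (F u v)).
Proof. by rewrite /sweedler linear_sum. Qed.

Lemma sweedler_scalar (W : lmodType k) (L : {scalar W}) (F : U -> V -> W)
    (t : tens U V) :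
  L (sweedler t F) = sweedler t (fun u v => L (F u v)).
Proof. by rewrite /sweedler linear_sum. Qed.

End SweedlerTheory.

Lemma eq_tmap (k : fieldType) (U U' V V' : lmodType k)
    (f f' : {linear U -> U'}) (g g' : {linear V -> V'}) :
  f =1 f' -> g =1 g' -> tmap f g =1 tmap f' g'.
Proof. by move=> ff gg t; apply: eq_sweedler => u v; rewrite ff gg. Qed.

Section Lift.
Variables (k : fieldType) (U V W : lmodType k) (F : U -> V -> W).
Hypothesis bF : bilin F.

Definition tlift of bilin F := fun t : tens U V => sweedler t F.

HB.instance Definition _ (b : bilin F) :=
  GRing.isLinear.Build k (tens U V) W _ (tlift b) (sweedler_linear b).

Lemma sweedler_sweedler (U' V' : lmodType k) (H : U' -> V' -> tens U V) t :
  sweedler (sweedler t H) F = sweedler t (fun u v => sweedler (H u v) F).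
Proof. exact: (sweedler_linmap (tlift bF)). Qed.

Lemma sweedler_tmap (U' V' : lmodType k) (f : {linear U' -> U})
    (g : {linear V' -> V}) t :
  sweedler (tmap f g t) F = sweedler t (fun u v => F (f u) (g v)).
Proof.
by rewrite sweedler_sweedler; apply: eq_sweedler => u v; exact: sweedlerE.
Qed.
End Lift.

Lemma sweedler_bilinl (k : fieldType) (U V W X : lmodType k) 
    (F : U -> V -> W -> X) (s : tens V W) :
  (forall v w, linear (fun u => F u v w)) ->
  linear (fun u => sweedler s (F u)).
Proof.
move=> lF a u u'; rewrite /sweedler scaler_sumr -big_split /=.
by apply: eq_bigr => p _; exact: lF.
Qed.

Lemma sweedler_tassoc (k : fieldType) (U V W X : lmodType k)
    (F : U -> V -> W -> X) (t : tens (tens U V) W) :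
  (forall u, bilin (F u)) -> (forall v w, linear (fun u => F u v w)) ->
  sweedler (tassoc t) (fun u s => sweedler s (F u)) =
  sweedler t (fun x w => sweedler x (fun u v => F u v w)).
Proof.
move=> bF lF.
have b : bilin (fun u s => sweedler s (F u)).
  by split=> [s|u]; [exact: sweedler_bilinl|exact: sweedler_linear].
rewrite (sweedler_sweedler b); apply: eq_sweedler => x w.
rewrite (sweedler_sweedler b); apply: eq_sweedler => u v.
by rewrite (sweedlerE b) (sweedlerE (bF u)).
Qed.

Definition tprodr (k : fieldType) (U V : lmodType k) (v : V) (u : U) : tens U V :=
  u \ot v.

HB.instance Definition _ (k : fieldType) (U V : lmodType k) (v : V) :=
  GRing.isLinear.Build k U (tens U V) _ (tprodr v) ((tprod_bilin U V).1 v).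

Section SweedlerPush.
Variables (k : fieldType) (U V : lmodType k) (t : tens U V).

Lemma sweedler_scaler (W : lmodType k) (a : k) (F : U -> V -> W) :
  a *: sweedler t F = sweedler t (fun u v => a *: F u v).
Proof. by rewrite /sweedler scaler_sumr. Qed.

Lemma sweedler_scalel (W : lmodType k) (F : U -> V -> k) (w : W) :
  sweedler t F *: w = sweedler t (fun u v => F u v *: w).
Proof. by rewrite /sweedler scaler_suml. Qed.

Lemma sweedler_tprodl (W X : lmodType k) (F : U -> V -> W) (x : X) :
  sweedler t F \ot x = sweedler t (fun u v => F u v \ot x).
Proof. exact: (sweedler_linmap (tprodr x)). Qed.

Lemma sweedler_tprodr (W X : lmodType k) (F : U -> V -> W) (x : X) :
  x \ot sweedler t F = sweedler t (fun u v => x \ot F u v).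
Proof. exact: (sweedler_linmap (tprod x)). Qed.
End SweedlerPush.

Lemma scalar_bilin (k : fieldType) (U V : lmodType k)
    (f : {scalar U}) (g : {scalar V}) :
  @bilin k U V k^o (fun u v => f u * g v).
Proof.
split=> [v a u u' | u a v v']; rewrite linearP /=.
  by rewrite mulrDl -mulrA.
by rewrite mulrDr mulrCA.
Qed.

Record coalg (k : fieldType) := Coalg {
  coalg_car :> lmodType k;
  cdelta : {linear coalg_car -> tens coalg_car coalg_car};
  ceps : {scalar coalg_car};
  cdeltaA : forall c,
    tassoc (tmap cdelta idfun (cdelta c)) = tmap idfun cdelta (cdelta c);
  cepsr : forall c, sweedler (cdelta c) (fun x y => ceps y *: x) = c;
  cepsl : forall c, sweedler (cdelta c) (fun x y => ceps x *: y) = c }.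

Arguments cdelta {k} C : rename.
Arguments ceps {k} C : rename.

Definition is_coalg_map (k : fieldType) (C D : coalg k)
    (f : {linear C -> D}) : Prop :=
  (forall c, cdelta D (f c) = tmap f f (cdelta C c)) /\
  (forall c, ceps D (f c) = ceps C c).

Section Convolution.
Variables (k : fieldType) (C : coalg k).

Definition conv (f g : C -> k) (c : C) : k :=
  sweedler (cdelta C c) (fun x y => f x * g y).

Definition conv_inverse (f g : C -> k) : Prop :=
  (forall c, conv f g c = ceps C c) /\ (forall c, conv g f c = ceps C c).

(** Evaluation of [F c_(1) c_(2) c_(3)]. *)
Definition sweedler3 (W : nmodType) (c : C) (F : C -> C -> C -> W) : W :=
  sweedler (cdelta C c) (fun x y => sweedler (cdelta C y) (F x)).

Lemma sweedlerA (W : lmodType k) (c : C) (F : C -> C -> C -> W) :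
  (forall u, bilin (F u)) -> (forall v w, linear (fun u => F u v w)) ->
  sweedler (cdelta C c) (fun x z => sweedler (cdelta C x) (fun x1 x2 => F x1 x2 z))
    = sweedler3 c F.
Proof.
move=> bF lF.
have b : bilin (fun u s => sweedler s (F u)).
  by split=> [s|u]; [exact: sweedler_bilinl|exact: sweedler_linear].
have b' : bilin (fun x w => sweedler x (fun u v => F u v w)).
  split=> [w|x a w w']; first apply: sweedler_linear.
    by split=> [v|u]; [exact: lF|exact: (bF u).1].
  rewrite /sweedler scaler_sumr -big_split /=.
  by apply: eq_bigr => p _; exact: (bF p.1).2.
have := congr1 (fun t => sweedler t (fun u s => sweedler s (F u))) (cdeltaA c).
by rewrite sweedler_tassoc // !sweedler_tmap.
Qed.
End Convolution.

Record lcomod (k : fieldType) (C : coalg k) := LComod {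
  lcomod_car :> lmodType k;
  coact : {linear lcomod_car -> tens C lcomod_car};
  coactA : forall m,
    tassoc (tmap (cdelta C) idfun (coact m)) = tmap idfun coact (coact m);
  coact_eps : forall m, sweedler (coact m) (fun x n => ceps C x *: n) = m }.

Arguments coact {k C} M : rename.

Record lcomod_hom (k : fieldType) (C : coalg k) (M N : lcomod C) := LComodHom {
  lcomod_map :> {linear M -> N};
  lcomod_mapP : forall m, coact N (lcomod_map m) = tmap idfun lcomod_map (coact M m) }.

Definition lcomod_isom (k : fieldType) (C : coalg k) (M N : lcomod C) : Prop :=
  exists (f : lcomod_hom M N) (g : lcomod_hom N M), cancel f g /\ cancel g f.

(** [gcast h] identifies the components of a family at equal group elements,
    e.g. [C (a * b * c)] and [C (a * (b * c))]. *)

Section Cast.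
Variables (k : fieldType) (G : groupType) (V : G -> lmodType k).

Definition gcast (a b : G) (h : a = b) : V a -> V b :=
  eq_rect a (fun c => V a -> V c) idfun b h.

Lemma gcast_linear (a b : G) (h : a = b) : linear (gcast h).
Proof. by case: b / h. Qed.

HB.instance Definition _ a b h := GRing.isLinear.Build k (V a) (V b) _
  (@gcast a b h) (gcast_linear h).

Lemma gcast_id (a : G) (h : a = a) x : gcast h x = x.
Proof. by rewrite (eq_irrelevance h erefl). Qed.

Lemma gcast_comp (a b c : G) (h : a = b) (h' : b = c) x :
  gcast h' (gcast h x) = gcast (etrans h h') x.
Proof. by case: c / h'. Qed.
End Cast.

Record gcoalg (k : fieldType) (G : groupType) := GCoalg {
  gcoalg_car :> G -> lmodType k;
  gdelta : forall a b : G,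
    {linear gcoalg_car (a * b)%g -> tens (gcoalg_car a) (gcoalg_car b)};
  geps : {scalar gcoalg_car 1%g};
  gdeltaA : forall (a b c : G) (x : gcoalg_car (a * (b * c))%g),
    tassoc (tmap (gdelta a b) idfun (gdelta (a * b)%g c (gcast (mulgA a b c) x)))
      = tmap idfun (gdelta b c) (gdelta a (b * c)%g x);
  gepsr : forall (a : G) (x : gcoalg_car a),
    sweedler (gdelta a 1%g (gcast (esym (mulg1 a)) x)) (fun y z => geps z *: y) = x;
  gepsl : forall (a : G) (x : gcoalg_car a),
    sweedler (gdelta 1%g a (gcast (esym (mul1g a)) x)) (fun y z => geps y *: z) = x }.

Arguments gdelta {k G} C a b : rename.
Arguments geps {k G} C : rename.

Record gcoalg_hom (k : fieldType) (G : groupType) (C D : gcoalg k G) := GCoalgHom {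
  gcoalg_map :> forall a, {linear C a -> D a};
  gcoalg_map_eps : forall c, geps D (gcoalg_map 1%g c) = geps C c;
  gcoalg_map_delta : forall (a b : G) (c : C (a * b)%g),
    tmap (gcoalg_map a) (gcoalg_map b) (gdelta C a b c)
      = gdelta D a b (gcoalg_map (a * b)%g c) }.

Definition gcoalg_isom (k : fieldType) (G : groupType) (C D : gcoalg k G) : Prop :=
  exists (phi : gcoalg_hom C D) (psi : gcoalg_hom D C),
    (forall a, cancel (phi a) (psi a)) /\ (forall a, cancel (psi a) (phi a)).

Definition strong (k : fieldType) (G : groupType) (C : gcoalg k G) : Prop :=
  forall a b, injective (gdelta C a b).

Section UnitComponent.
Variables (k : fieldType) (G : groupType) (C : gcoalg k G).

Definition udelta : {linear C 1%g -> tens (C 1%g) (C 1%g)} :=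
  gdelta C 1%g 1%g \o gcast (esym (mul1g 1%g)).

Definition ucoact (a : G) : {linear C a -> tens (C 1%g) (C a)} :=
  gdelta C 1%g a \o gcast (esym (mul1g a)).

Lemma gdeltaA_cast (a b c d e t : G) (hd : d = (a * b)%g) (he : e = (b * c)%g)
    (htl : t = (d * c)%g) (htr : t = (a * e)%g) (x : C t) :
  tassoc (tmap (gdelta C a b \o gcast hd) idfun (gdelta C d c (gcast htl x))) =
  tmap idfun (gdelta C b c \o gcast he) (gdelta C a e (gcast htr x)).
Proof.
subst d e t.
rewrite (@eq_tmap _ _ _ _ _ _ (gdelta C a b) _ idfun) //.
rewrite [RHS](@eq_tmap _ _ _ _ _ _ idfun _ (gdelta C b c)) //.
by rewrite -gdeltaA gcast_comp !gcast_id.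
Qed.

Lemma ucoactA a (x : C a) :
  tassoc (tmap udelta idfun (ucoact a x)) = tmap idfun (ucoact a) (ucoact a x).
Proof. exact: gdeltaA_cast. Qed.

Lemma udeltaA (x : C 1%g) :
  tassoc (tmap udelta idfun (udelta x)) = tmap idfun udelta (udelta x).
Proof. exact: ucoactA. Qed.

Lemma uepsr (x : C 1%g) :
  sweedler (udelta x) (fun y z => geps C z *: y) = x.
Proof.
by rewrite -[RHS]gepsr /= (eq_irrelevance (mul1g 1%g) (mulg1 1%g)).
Qed.

Lemma uepsl (x : C 1%g) :
  sweedler (udelta x) (fun y z => geps C y *: z) = x.
Proof. exact: gepsl. Qed.

(** The coalgebra [C_e] and its left comodules [C_a]. *)
Definition unit_coalg : coalg k := Coalg udeltaA uepsr uepsl.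

Definition comp_lcomod (a : G) : lcomod unit_coalg :=
  @LComod k unit_coalg (C a) (ucoact a) (@ucoactA a) (@gepsl k G C a).

(** A family of linear maps [C -> k<G>] is identified with a family of
    functionals [u a] on the components [C a]. *)
Definition gconv_invertible (u : forall a, {scalar C a}) : Prop :=
  exists v : forall a : G, {scalar C (a^-1)%g},
    forall (a : G) (c : C 1%g),
      sweedler (gdelta C a a^-1%g (gcast (esym (mulgV a)) c))
        (fun x y => u a x * v a y) = geps C c /\
      sweedler (gdelta C a^-1%g a (gcast (esym (mulVg a)) c))
        (fun x y => v a x * u a y) = geps C c.

Definition cocleft : Prop :=
  exists u : forall a, {scalar C a}, gconv_invertible u.
End UnitComponent.

Section Crossed.
Variables (k : fieldType) (G : groupType) (C : coalg k).

Definition weak_action (lam : G -> {linear C -> C}) : Prop :=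
  forall a, is_coalg_map (lam a).

(** [g a b] is the convolution inverse of [f a b]; it is determined by [f]. *)
Record factor_set (lam : G -> {linear C -> C})
    (f g : G -> G -> {scalar C}) : Prop := FactorSet {
  fs_inv : forall a b, conv_inverse (f a b) (g a b);
  fs_lam1 : forall c, lam 1%g c =
    sweedler3 c (fun x y z => (f 1%g 1%g x * g 1%g 1%g z) *: y);
  fs_f1l : forall a c, f 1%g a c = f 1%g 1%g c;
  fs_f1r : forall a c, f a 1%g c = f 1%g 1%g (lam a c);
  fs_cocycle : forall (a b c : G) x,
    sweedler (cdelta C x) (fun y z => f b c (lam a y) * f a (b * c)%g z) =
    sweedler (cdelta C x) (fun y z => f a b y * f (a * b)%g c z);
  fs_twist : forall (a b : G) x,
    sweedler (cdelta C x) (fun y z => f a b z *: lam b (lam a y)) =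
    sweedler (cdelta C x) (fun y z => f a b y *: lam (a * b)%g z) }.

Definition normalized (f : G -> G -> {scalar C}) : Prop :=
  forall a c, f a 1%g c = ceps C c /\ f 1%g a c = ceps C c.

Section CrossedCoproduct.
Variables (lam : G -> {linear C -> C}) (f g : G -> G -> {scalar C}).
Hypothesis lamP : weak_action lam.
Hypothesis fP : factor_set lam f g.

Definition crossed_delta (a b : G) (c : C) : tens C C :=
  sweedler3 c (fun x y z => x \ot (f a b z *: lam a y)).

Definition crossed_twist (a b : G) (c : C) : C :=
  sweedler (cdelta C c) (fun y z => f a b z *: lam a y).

Lemma crossed_twist_linear a b : linear (crossed_twist a b).
Proof.
move=> s x y; rewrite /crossed_twist linearP.
by apply: sweedler_linear; bilin_tac.
Qed.

HB.instance Definition _ a b := GRing.isLinear.Build k C C _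
  (crossed_twist a b) (@crossed_twist_linear a b).

Lemma crossed_deltaE a b c :
  crossed_delta a b c = tmap idfun (crossed_twist a b) (cdelta C c).
Proof.
rewrite /crossed_delta /sweedler3 /tmap; apply: eq_sweedler => x y /=.
by rewrite /crossed_twist (sweedler_linmap (tprod x)).
Qed.

Lemma crossed_delta_linear a b : linear (crossed_delta a b).
Proof. by move=> s x y; rewrite !crossed_deltaE !linearP. Qed.

HB.instance Definition _ a b := GRing.isLinear.Build k C (tens C C) _
  (crossed_delta a b) (@crossed_delta_linear a b).

Lemma crossed_twist_lam a b c z : crossed_twist b c (lam a z) =
  sweedler (cdelta C z) (fun p q => f b c (lam a q) *: lam b (lam a p)).
Proof.
by rewrite /crossed_twist (lamP a).1 sweedler_tmap //; bilin_tac.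
Qed.

Lemma crossed_twistA (a b c : G) y :
  sweedler (cdelta C y)
    (fun z w => f a (b * c)%g w *: crossed_twist b c (lam a z)) =
  sweedler (cdelta C y)
    (fun z w => f a b z *: crossed_twist (a * b)%g c w).
Proof.
transitivity (sweedler3 y (fun p q w =>
    (f b c (lam a q) * f a (b * c)%g w) *: lam b (lam a p))).
  rewrite -sweedlerA; try by [move=> ?; bilin_tac|lin_tac].
  apply: eq_sweedler => z w; rewrite crossed_twist_lam sweedler_scaler.
  by apply: eq_sweedler => p q; rewrite scalerA mulrC.
transitivity (sweedler3 y (fun p q w =>
    (f a b q * f (a * b)%g c w) *: lam b (lam a p))).
  apply: eq_sweedler => p z; rewrite -!sweedler_scalel.
  by rewrite (fs_cocycle fP).
transitivity (sweedler3 y (fun p q w =>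
    (f a b p * f (a * b)%g c w) *: lam (a * b)%g q)).
  rewrite -!sweedlerA; try by [move=> ?; bilin_tac|lin_tac].
  apply: eq_sweedler => z w.
  transitivity (f (a * b)%g c w *: sweedler (cdelta C z)
      (fun p q => f a b q *: lam b (lam a p))).
    rewrite sweedler_scaler; apply: eq_sweedler => p q.
    by rewrite scalerA mulrC.
  rewrite (fs_twist fP) sweedler_scaler; apply: eq_sweedler => p q.
  by rewrite scalerA mulrC.
apply: eq_sweedler => p z; rewrite sweedler_scaler.
by apply: eq_sweedler => q w; rewrite scalerA.
Qed.

Lemma crossed_twist_delta (a b c : G) y :
  tmap (crossed_twist a b) (crossed_twist (a * b)%g c) (cdelta C y) =
  tmap idfun (crossed_twist b c) (cdelta C (crossed_twist a (b * c)%g y)).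
Proof.
transitivity (sweedler3 y (fun r s w =>
    lam a r \ot (f a b s *: crossed_twist (a * b)%g c w))).
  rewrite -sweedlerA; try by [move=> ?; bilin_tac|lin_tac].
  apply: eq_sweedler => x w; rewrite [in LHS]/crossed_twist sweedler_tprodl.
  by apply: eq_sweedler => r s; rewrite tprodZl tprodZr.
transitivity (sweedler3 y (fun r s w =>
    lam a r \ot (f a (b * c)%g w *: crossed_twist b c (lam a s)))).
  apply: eq_sweedler => r z; rewrite -!sweedler_tprodr.
  by rewrite crossed_twistA.
rewrite -sweedlerA; try by [move=> ?; bilin_tac|lin_tac].
rewrite [in RHS]/crossed_twist !sweedler_linmap; apply: eq_sweedler => u w.
rewrite !linearZ /= (lamP a).1.
rewrite [tmap idfun _ _](sweedler_tmap (tmap_bilin _ _)) sweedler_scaler.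
by apply: eq_sweedler => r s; rewrite tprodZr.
Qed.

Lemma gcast_const (a b : G) (h : a = b) (c : C) : gcast (V := fun=> C) h c = c.
Proof. by case: b / h. Qed.

Lemma crossed_deltaA (a b c : G) (x : C) :
  tassoc (tmap (crossed_delta a b) idfun
    (crossed_delta (a * b)%g c (gcast (V := fun=> C) (mulgA a b c) x))) =
  tmap idfun (crossed_delta b c) (crossed_delta a (b * c)%g x).
Proof.
rewrite gcast_const !crossed_deltaE.
transitivity (sweedler3 x (fun u v w =>
    u \ot (crossed_twist a b v \ot crossed_twist (a * b)%g c w))).
  rewrite -sweedlerA; try by [move=> ?; bilin_tac|lin_tac].
  rewrite [tmap (crossed_delta a b) idfun _](sweedler_tmap (tmap_bilin _ _)).
  rewrite sweedler_linmap; apply: eq_sweedler => u w /=.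
  rewrite crossed_deltaE /tmap sweedler_tprodl sweedler_linmap.
  by apply: eq_sweedler => r s; rewrite /= tassocE.
rewrite [RHS](sweedler_tmap (tmap_bilin _ _)).
apply: eq_sweedler => u v /=; rewrite crossed_deltaE -crossed_twist_delta.
by rewrite -sweedler_tprodr.
Qed.

Lemma crossed_epsr (a : G) (x : C) :
  sweedler (crossed_delta a 1%g (gcast (V := fun=> C) (esym (mulg1 a)) x))
    (fun y z => g 1%g 1%g z *: y) = x.
Proof.
rewrite gcast_const crossed_deltaE sweedler_tmap; last by bilin_tac.
rewrite -[RHS]cepsr; apply: eq_sweedler => y z /=; congr (_ *: _).
rewrite /crossed_twist sweedler_scalar.
rewrite -(lamP a).2 -((fs_inv fP 1%g 1%g).2 (lam a z)) /conv (lamP a).1.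
rewrite (sweedler_tmap (scalar_bilin _ _)).
by apply: eq_sweedler => p q; rewrite linearZ /= (fs_f1r fP) mulrC.
Qed.

Lemma crossed_epsl (a : G) (x : C) :
  sweedler (crossed_delta 1%g a (gcast (V := fun=> C) (esym (mul1g a)) x))
    (fun y z => g 1%g 1%g y *: z) = x.
Proof.
rewrite gcast_const crossed_deltaE sweedler_tmap; last by bilin_tac.
have twist1 v : crossed_twist 1%g a v =
    sweedler (cdelta C v) (fun r z => f 1%g 1%g r *: z).
  transitivity (sweedler3 v (fun r s' q => sweedler (cdelta C s')
      (fun s t => (f 1%g 1%g r * (g 1%g 1%g t * f 1%g 1%g q)) *: s))).
    rewrite -sweedlerA.
    - apply: eq_sweedler => p q.
      rewrite (fs_f1l fP) (fs_lam1 fP) /sweedler3 sweedler_scaler.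
      apply: eq_sweedler => r s'; rewrite sweedler_scaler.
      by apply: eq_sweedler => s t; rewrite scalerA mulrC mulrA.
    - move=> r; split=> [q e s s'|s']; last by apply: sweedler_bilinl; lin_tac.
      by rewrite linearP; apply: sweedler_linear; bilin_tac.
    - by move=> s' q; apply: sweedler_bilinl; lin_tac.
  apply: eq_sweedler => r z; rewrite -[in RHS](cepsr z) sweedler_scaler.
  rewrite (@sweedlerA _ _ C z (fun s t q =>
    (f 1%g 1%g r * (g 1%g 1%g t * f 1%g 1%g q)) *: s));
    try by [move=> ?; bilin_tac|lin_tac].
  apply: eq_sweedler => s w; rewrite -((fs_inv fP 1%g 1%g).2 w) /conv.
  by rewrite scalerA /sweedler mulr_sumr scaler_suml.
rewrite -[RHS]cepsl.
transitivity (sweedler3 x (fun u r z => (g 1%g 1%g u * f 1%g 1%g r) *: z)).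
  apply: eq_sweedler => u v; rewrite /= twist1 sweedler_scaler.
  by apply: eq_sweedler => r z; rewrite scalerA.
rewrite -sweedlerA; try by [move=> ?; bilin_tac|lin_tac].
apply: eq_sweedler => y z; rewrite -sweedler_scalel.
by rewrite -((fs_inv fP 1%g 1%g).2 y).
Qed.

(** The components [C >< p_a] are all copies of [C]. *)
Definition crossed_gcoalg : gcoalg k G :=
  @GCoalg k G (fun=> C) crossed_delta (g 1%g 1%g)
    crossed_deltaA crossed_epsr crossed_epsl.
End CrossedCoproduct.
End Crossed.

Arguments crossed_gcoalg {k G C lam f g} lamP fP.

(* Main.v *)
Require Import Defs.
From HB Require Import structures.
From mathcomp Require Import all_boot all_order all_algebra.
From mathcomp Require Import boolp classical_sets.

Set Implicit Arguments.
Unset Strict Implicit.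
Unset Printing Implicit Defensive.

Import GRing.Theory.
Local Open Scope ring_scope.

(** The idea is to read everything in the graded dual of [C]: functionals
    [p] on [C a] and [q] on [C b] have a convolution product [gconv p q] on
    [C (a * b)], and this partial algebra acts on the components of [C] from
    both sides, by [hitr q = (id (x) q) o Delta] and
    [hitl p = (p (x) id) o Delta].  A cleft family is then a choice of an
    invertible homogeneous element in every degree, and a crossed coproduct is
    the dual of a crossed product of the degree one part with [G].

    Cocleft group coalgebras are normalized crossed coproducts
    ([crossed_of_cocleft]).  After replacing [u a] by [v 1 * u a] one may
    suppose that [u 1] is the counit.  The map [hitr (u a) : C a -> C 1] is
    bijective with inverse [hitr (v a)], and transporting the
    comultiplication along these bijections gives the crossed coproduct for
    the action by conjugation, [lam a = hitl (u a) o hitr (v a)], and the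
    cocycle [f a b = u a * u b * v (a * b)].  The axioms of a factor set are
    then cancellations of [u a] against [v a].

    Crossed coproducts are strong and have isomorphic components
    ([strong_of_crossed]).  All components are the same space, and the
    coaction of the unit component on the component of degree [a] does not
    depend on [a].  The comultiplication
    [c |-> c_(1) (x) lam_a(c_(2)) f_(a,b)(c_(3))] is injective because the
    counit and the convolution inverse of [f a b] recover [c].

    Strong group coalgebras with isomorphic components are cocleft
    ([cocleft_of_strong]).  A colinear isomorphism [phi] from [C a] to [C 1]
    is [hitr u] for the functional [u = eps o phi].  Strongness makes
    [hitr u : C 1 -> C a^-1] injective, so that the counit extends along it to
    a functional [v], which satisfies [v * u = eps] by construction; the
    equality [u * v = eps] then follows from [u * v * u = u] and the
    surjectivity of [phi]. *)

(** * Contraction of tensors by functionals *)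

Section Contraction.
Variables (k : fieldType) (U V : lmodType k).

Definition contr_r (q : {scalar V}) (t : tens U V) : U :=
  sweedler t (fun x y => q y *: x).

Definition contr_l (p : {scalar U}) (t : tens U V) : V :=
  sweedler t (fun x y => p x *: y).

Lemma contr_r_bilin (q : {scalar V}) : bilin (fun (x : U) y => q y *: x).
Proof. by bilin_tac. Qed.

Lemma contr_l_bilin (p : {scalar U}) : bilin (fun x (y : V) => p x *: y).
Proof. by bilin_tac. Qed.

HB.instance Definition _ q := GRing.isLinear.Build k (tens U V) U _
  (contr_r q) (sweedler_linear (contr_r_bilin q)).

HB.instance Definition _ p := GRing.isLinear.Build k (tens U V) V _
  (contr_l p) (sweedler_linear (contr_l_bilin p)).

Lemma contr_rE q u v : contr_r q (u \ot v) = q v *: u.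
Proof. exact: (sweedlerE (contr_r_bilin q)). Qed.

Lemma contr_lE p u v : contr_l p (u \ot v) = p u *: v.
Proof. exact: (sweedlerE (contr_l_bilin p)). Qed.

Lemma eq_contr_r (q q' : {scalar V}) : q =1 q' -> contr_r q =1 contr_r q'.
Proof. by move=> qq t; apply: eq_sweedler => x y; rewrite qq. Qed.

Lemma eq_contr_l (p p' : {scalar U}) : p =1 p' -> contr_l p =1 contr_l p'.
Proof. by move=> pp t; apply: eq_sweedler => x y; rewrite pp. Qed.

Lemma scalar_contr_r (p : {scalar U}) (q : {scalar V}) t :
  p (contr_r q t) = sweedler t (fun x y => p x * q y).
Proof.
rewrite /contr_r sweedler_scalar; apply: eq_sweedler => x y.
by rewrite linearZ /= mulrC.
Qed.

Lemma scalar_contr_l (p : {scalar U}) (q : {scalar V}) t :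
  q (contr_l p t) = sweedler t (fun x y => p x * q y).
Proof.
by rewrite /contr_l sweedler_scalar; apply: eq_sweedler => x y; rewrite linearZ.
Qed.
End Contraction.

Arguments contr_r {k U V}.
Arguments contr_l {k U V}.

Section ContractionMaps.
Variable k : fieldType.
Implicit Types U V W X : lmodType k.

Lemma tmap_tmap U V U' V' U'' V'' (f' : {linear U' -> U''})
    (g' : {linear V' -> V''}) (f : {linear U -> U'}) (g : {linear V -> V'}) t :
  tmap f' g' (tmap f g t) = tmap (f' \o f) (g' \o g) t.
Proof. by rewrite [LHS](sweedler_tmap (tmap_bilin _ _)). Qed.

Lemma tmap_id U V (f : {linear U -> U}) (g : {linear V -> V}) t :
  f =1 id -> g =1 id -> tmap f g t = t.
Proof.
move=> f1 g1; rewrite [RHS]tens_sum; apply: eq_bigr => p _.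
by rewrite f1 g1.
Qed.

Lemma contr_r_tmap U V U' V' (f : {linear U -> U'}) (g : {linear V -> V'})
    (q : {scalar V'}) t :
  contr_r q (tmap f g t) = f (contr_r (q \o g) t).
Proof.
rewrite /contr_r (sweedler_tmap (contr_r_bilin _ q)) sweedler_linmap.
by apply: eq_sweedler => x y; rewrite linearZ.
Qed.

Lemma contr_l_tmap U V U' V' (f : {linear U -> U'}) (g : {linear V -> V'})
    (p : {scalar U'}) t :
  contr_l p (tmap f g t) = g (contr_l (p \o f) t).
Proof.
rewrite /contr_l (sweedler_tmap (contr_l_bilin _ p)) sweedler_linmap.
by apply: eq_sweedler => x y; rewrite linearZ.
Qed.

(** Pure tensors generate the triple tensor product, so linear maps out of its
    two bracketings are compared on them. *)
Lemma tassoc_ext U V W X (f : {linear tens U (tens V W) -> X})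
    (g : {linear tens (tens U V) W -> X}) :
  (forall u v w, f (u \ot (v \ot w)) = g ((u \ot v) \ot w)) ->
  forall t, f (tassoc t) = g t.
Proof.
move=> fg; elim/tens_ind => [|x y|s w]; first by rewrite !linear0.
  by rewrite !linearD => -> ->.
elim/tens_ind: s => [|x y|u v]; last by rewrite tassocE fg.
  by rewrite (bilin0l (tprod_bilin _ _)) !linear0.
by rewrite tprodDl !linearD => -> ->.
Qed.

Lemma linear_contr_r U V W (f : {linear U -> W}) (q : {scalar V}) t :
  f (contr_r q t) = sweedler t (fun x y => q y *: f x).
Proof.
by rewrite /contr_r sweedler_linmap; apply: eq_sweedler => x y; rewrite linearZ.
Qed.

Lemma linear_contr_l U V W (f : {linear V -> W}) (p : {scalar U}) t :
  f (contr_l p t) = sweedler t (fun x y => p x *: f y).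
Proof.
by rewrite /contr_l sweedler_linmap; apply: eq_sweedler => x y; rewrite linearZ.
Qed.

Section Assoc.
Variables U V W : lmodType k.

Lemma tassoc_contr3 (q : {scalar W}) (t : tens (tens U V) W) :
  tmap idfun (contr_r q) (tassoc t) = contr_r q t.
Proof.
move: t; apply: tassoc_ext => u v w /=.
by rewrite tmapE /= !contr_rE /= tprodZr.
Qed.

Lemma tassoc_contr1 (p : {scalar U}) (t : tens (tens U V) W) :
  contr_l p (tassoc t) = tmap (contr_l p) idfun t.
Proof.
move: t; apply: tassoc_ext => u v w /=.
by rewrite tmapE /= !contr_lE tprodZl.
Qed.

Lemma tassoc_contr2 (q : {scalar V}) (t : tens (tens U V) W) :
  tmap idfun (contr_l q) (tassoc t) = tmap (contr_r q) idfun t.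
Proof.
move: t; apply: tassoc_ext => u v w /=.
by rewrite !tmapE /= contr_lE contr_rE tprodZl tprodZr.
Qed.
End Assoc.
End ContractionMaps.

(** * Convolution and the two actions of functionals *)

Section Hit.
Variables (k : fieldType) (G : groupType) (C : gcoalg k G).
Implicit Types a b c d e s t : G.

(** Carrying an arbitrary proof [h] of the index identity, instead of the
    index [a * b] itself, lets all the associativity and unit laws of [G]
    live in side proofs, so that no transport shows up in the statements
    below. *)
Definition gdl a b t (h : t = (a * b)%g) (x : C t) : tens (C a) (C b) :=
  gdelta C a b (gcast h x).

HB.instance Definition _ a b t h :=
  GRing.Linear.copy (@gdl a b t h) (gdelta C a b \o gcast h).

Definition hitr a b t (h : t = (a * b)%g) (q : {scalar C b}) (x : C t) : C a :=
  contr_r q (gdl h x).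

HB.instance Definition _ a b t h q :=
  GRing.Linear.copy (@hitr a b t h q) (contr_r q \o gdl h).

Definition hitl a b t (h : t = (a * b)%g) (p : {scalar C a}) (x : C t) : C b :=
  contr_l p (gdl h x).

HB.instance Definition _ a b t h p :=
  GRing.Linear.copy (@hitl a b t h p) (contr_l p \o gdl h).

Definition gconv a b t (h : t = (a * b)%g) (p : {scalar C a})
  (q : {scalar C b}) (x : C t) : k := p (hitr h q x).

HB.instance Definition _ a b t h p q :=
  GRing.Linear.copy (@gconv a b t h p q) (p \o hitr h q).

Lemma eq_hitr a b t (h h' : t = (a * b)%g) (q q' : {scalar C b}) :
  q =1 q' -> hitr h q =1 hitr h' q'.
Proof. by rewrite (eq_irrelevance h h') => qq x; exact: eq_contr_r. Qed.

Lemma eq_hitl a b t (h h' : t = (a * b)%g) (p p' : {scalar C a}) :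
  p =1 p' -> hitl h p =1 hitl h' p'.
Proof. by rewrite (eq_irrelevance h h') => pp x; exact: eq_contr_l. Qed.

Lemma gconvE a b t (h : t = (a * b)%g) p q x :
  gconv h p q x = sweedler (gdl h x) (fun y z => p y * q z).
Proof. exact: scalar_contr_r. Qed.

Lemma gconv_hitl a b t (h : t = (a * b)%g) p q x :
  gconv h p q x = q (hitl h p x).
Proof. by rewrite gconvE -scalar_contr_l. Qed.

(** The next three lemmas are coassociativity with one of the three tensor
    factors contracted by a functional: the last, the first and the middle
    one. *)
Lemma gdl_hitr a b c e s t (hs : s = (t * c)%g) (ht : t = (a * b)%g)
    (he : e = (b * c)%g) (hx : s = (a * e)%g) (q : {scalar C c}) x :
  gdl ht (hitr hs q x) = tmap idfun (hitr he q) (gdl hx x).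
Proof.
have := congr1 (tmap idfun (contr_r q)) (gdeltaA_cast ht he hs hx x).
by rewrite tassoc_contr3 contr_r_tmap tmap_tmap.
Qed.

Lemma gdl_hitl a b c d s t (hs : s = (a * t)%g) (ht : t = (b * c)%g)
    (hd : d = (a * b)%g) (hx : s = (d * c)%g) (p : {scalar C a}) x :
  gdl ht (hitl hs p x) = tmap (hitl hd p) idfun (gdl hx x).
Proof.
have := congr1 (contr_l p) (gdeltaA_cast hd ht hx hs x).
by rewrite tassoc_contr1 contr_l_tmap tmap_tmap => /esym.
Qed.

Lemma gdl_hit_mid a b c d e t (hd : d = (a * b)%g) (he : e = (b * c)%g)
    (hx : t = (d * c)%g) (hx' : t = (a * e)%g) (q : {scalar C b}) x :
  tmap (hitr hd q) idfun (gdl hx x) = tmap idfun (hitl he q) (gdl hx' x).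
Proof.
have := congr1 (tmap idfun (contr_l q)) (gdeltaA_cast hd he hx hx' x).
by rewrite tassoc_contr2 !tmap_tmap.
Qed.

(** Contracting once more shows that the two actions are associative for the
    convolution product and commute with each other. *)
Lemma hitr_hitr a b c e s t (hs : s = (t * c)%g) (ht : t = (a * b)%g)
    (he : e = (b * c)%g) (hx : s = (a * e)%g) p q x :
  hitr ht p (hitr hs q x) = hitr hx (gconv he p q) x.
Proof. rewrite -[LHS]/(contr_r p (gdl ht (hitr hs q x))) (gdl_hitr hs ht he hx).
exact: contr_r_tmap. Qed.

Lemma hitl_hitl a b c d s t (hs : s = (a * t)%g) (ht : t = (b * c)%g)
    (hd : d = (a * b)%g) (hx : s = (d * c)%g) p q x :
  hitl ht q (hitl hs p x) = hitl hx (gconv hd p q) x.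
Proof.
rewrite -[LHS]/(contr_l q (gdl ht (hitl hs p x))) (gdl_hitl hs ht hd hx).
rewrite contr_l_tmap /=.
by apply: eq_contr_l => y /=; rewrite gconv_hitl.
Qed.

Lemma hitl_hitr a b c d e s (hs : s = (d * c)%g) (ht : d = (a * b)%g)
    (he : e = (b * c)%g) (hx : s = (a * e)%g) p q x :
  hitl ht p (hitr hs q x) = hitr he q (hitl hx p x).
Proof. rewrite -[LHS]/(contr_l p (gdl ht (hitr hs q x))) (gdl_hitr hs ht he hx).
exact: contr_l_tmap. Qed.

Lemma hitr_eps a (h : a = (a * 1)%g) x : hitr h (geps C) x = x.
Proof. by rewrite -[RHS]gepsr (eq_irrelevance h (esym (mulg1 a))). Qed.

Lemma hitl_eps a (h : a = (1 * a)%g) x : hitl h (geps C) x = x.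
Proof. by rewrite -[RHS]gepsl (eq_irrelevance h (esym (mul1g a))). Qed.

Lemma eps_hitr a (q : {scalar C a}) (h : a = (1 * a)%g) x :
  geps C (hitr h q x) = q x.
Proof. by rewrite -[LHS]/(gconv h (geps C) q x) gconv_hitl hitl_eps. Qed.

Lemma gconv_invertibleP (u : forall a, {scalar C a}) :
  gconv_invertible u <-> exists v : forall a : G, {scalar C a^-1%g},
    (forall a h, gconv h (u a) (v a) =1 geps C) /\
    (forall a h, gconv h (v a) (u a) =1 geps C).
Proof.
split=> -[v]; last first.
  case=> uv vu; exists v => a c.
  split; first by rewrite -(uv a (esym (mulgV a))) gconvE.
  by rewrite -(vu a (esym (mulVg a))) gconvE.
move=> uv; exists v; split=> a h x; rewrite gconvE.
  by rewrite (eq_irrelevance h (esym (mulgV a))); exact: (uv a x).1.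
by rewrite (eq_irrelevance h (esym (mulVg a))); exact: (uv a x).2.
Qed.

End Hit.

(** * Left inverses of injective linear maps *)

Section LeftInverse.
Variables (k : fieldType) (U V : lmodType k) (f : {linear U -> V}).
Local Open Scope classical_set_scope.

Let transverse (W : set V) : Prop :=
  [/\ W 0, forall (a : k) x y, W x -> W y -> W (a *: x + y) &
      forall u, W (f u) -> f u = 0].

(** A maximal transverse subspace is a complement of the range of [f], since a
    vector outside the sum of the two could be adjoined to it. *)
Lemma exists_complement : exists W : set V,
  transverse W /\ forall y, exists u, W (y - f u).
Proof.
(* Adding [0] by hand makes the empty chain harmless. *)
pose P (W : set V) := transverse (W `|` [set 0]).
have [F FP Ftot|W [PW maxW]] := @Zorn_bigcup V P.
  split; first by right.
    move=> a x y; case=> [[X FX Xx]|->]; case=> [[Y FY Yy]|->].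
    - have inW Z : F Z -> Z x -> Z y ->
        (\bigcup_(X in F) X `|` [set 0]) (a *: x + y).
        move=> FZ Zx Zy; have [_ ZD _] := FP Z FZ.
        have [] := ZD a x y; [by left|by left|by left; exists Z|by right].
      by case: (Ftot X Y FX FY) => sub; [apply: (inW Y)|apply: (inW X)]; auto.
    - have [X0 XD _] := FP X FX.
      by have [] := XD a x 0 (or_introl Xx) X0; [left; exists X|right].
    - by rewrite scaler0 add0r; left; exists Y.
    - by right; rewrite /= scaler0 addr0.
  move=> u [[X FX Xu]|//]; have [_ _ XI] := FP X FX.
  by apply: XI; left.
exists (W `|` [set 0]); split=> // y; apply: contrapT => /forallNP ny.
have [W0 WD WI] := PW; set T := _ `|` _ in W0 WD WI ny.
have WZ a x : T x -> T (a *: x) by move=> Tx; rewrite -[_ *: _]addr0; apply: WD.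
pose W' : set V := [set x | exists a w, T w /\ x = a *: y + w].
have TW' x : T x -> W' x by move=> Tx; exists 0, x; rewrite scale0r add0r.
have W'y : W' y by exists 1, 0; rewrite scale1r addr0.
apply: (maxW W'); first split.
- by move=> x Wx; apply: TW'; left.
- move=> /(_ y W'y) Wy; apply: (ny 0); rewrite linear0 subr0.
  by left.
have -> : P W' = transverse W'.
  rewrite /P; congr transverse; apply/setUidPl => x ->; exact: TW'.
split; first exact: TW'.
  move=> a _ _ [b [w [Tw ->]]] [b' [w' [Tw' ->]]].
  exists (a * b + b'), (a *: w + w'); split; first exact: WD.
  by rewrite scalerDr scalerDl scalerA addrACA.
move=> u [a [w [Tw fu]]]; have [a0|a0] := eqVneq a 0.
  by apply: WI; rewrite fu a0 scale0r add0r.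
(* [f u = a *: y + w] with [a] invertible expresses [y] by [f] and [T]. *)
case: (ny (a^-1 *: u)); rewrite linearZ /= fu scalerDr scalerA mulVf //.
by rewrite scale1r opprD addNKr -scaleN1r; exact/WZ/WZ.
Qed.

(** The component along the range of [f] depends linearly on the vector. *)
Lemma linear_left_inverse : injective f ->
  exists g : {linear V -> U}, cancel f g.
Proof.
move=> injf; have [W [[W0 WD WI] /choice[g gP]]] := exists_complement.
have WN x : W x -> W (- x).
  by move=> Wx; rewrite -[- x]addr0 -scaleN1r; apply: WD.
have WS x y : W x -> W y -> W (x + y).
  by move=> Wx Wy; rewrite -[x]scale1r; apply: WD.
have uniqg y u : W (y - f u) -> g y = u.
  move=> Wu; apply/injf/eqP; rewrite -subr_eq0 -linearB; apply/eqP/WI.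
  rewrite linearB /=.
  have := WS _ _ Wu (WN _ (gP y)).
  by rewrite opprB addrC addrA subrK.
have lin_g : linear g.
  move=> a x y; apply: uniqg; rewrite linearP /= opprD addrACA -scalerBr.
  by apply: WD.
pose g' : {linear V -> U} :=
  HB.pack g (GRing.isLinear.Build k V U _ g lin_g).
by exists g' => u; apply: uniqg; rewrite subrr.
Qed.
End LeftInverse.

(** * From strong group coalgebras to cleft families *)

Section CocleftOfStrong.
Variables (k : fieldType) (G : groupType) (C : gcoalg k G).

(** The target is cofree, so a colinear map into it is determined by its
    composite with the counit. *)
Lemma colinear_hitr a (f : lcomod_hom (comp_lcomod C a) (comp_lcomod C 1%g))
    (h : a = (1 * a)%g) : f =1 hitr h (geps C \o f).
Proof.
move=> x; rewrite -[LHS](hitr_eps (esym (mulg1 1%g))).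
have := congr1 (contr_r (geps C)) (lcomod_mapP f x).
rewrite contr_r_tmap /hitr /=.
rewrite (eq_irrelevance (esym (mulg1 1%g)) (esym (mul1g 1%g))).
by rewrite (eq_irrelevance h (esym (mul1g a))).
Qed.

Lemma gdl_inj a b t (h : t = (a * b)%g) :
  strong C -> injective (gdl (C := C) h).
Proof. by move=> + x y /=; subst t; exact. Qed.

(** This is where both halves of the condition are combined: if [hitr u x] and
    [hitr u y] agree in [C a^-1], then so do the images of [Delta x] and
    [Delta y] under [id (x) hitr u], whose second factor is injective. *)
Lemma hitr_inj_of_strong a (u : {scalar C a}) (h : a = (1 * a)%g)
    (h' : 1%g = (a^-1 * a)%g) (g : {linear C 1%g -> C a}) :
  strong C -> cancel (hitr h u) g -> injective (hitr h' u).
Proof.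
move=> strC uK x y /(congr1 (gdl (C := C) (esym (mulg1 _)))).
rewrite !(gdl_hitr h' (esym (mulg1 _)) h h').
move/(congr1 (tmap idfun g)).
by rewrite !tmap_tmap !tmap_id //; exact: gdl_inj.
Qed.

Lemma invertible_of_colinear_iso a : strong C ->
  lcomod_isom (comp_lcomod C a) (comp_lcomod C 1%g) ->
  exists uv : {scalar C a} * {scalar C a^-1%g},
    (forall h, gconv h uv.1 uv.2 =1 geps C) /\
    (forall h, gconv h uv.2 uv.1 =1 geps C).
Proof.
move=> strC [f [g [fK gK]]].
pose u : {scalar C a} := geps C \o f.
have fE h : f =1 hitr h u := colinear_hitr f h.
have uK : cancel (hitr (esym (mul1g a)) u) g by move=> z; rewrite -fE fK.
have [p pK] :=
  linear_left_inverse (hitr_inj_of_strong (h' := esym (mulVg a)) strC uK).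
pose v : {scalar C a^-1%g} := geps C \o p.
have vuE h : gconv h v u =1 geps C.
  by move=> x; rewrite /gconv /v (eq_irrelevance h (esym (mulVg a))) /= pK.
exists (u, v); split=> // h z /=.
(* Evaluated at [hitr u (g z)], [u * v] gives [(u * v * u) (g z) = u (g z)]. *)
rewrite -[z]gK (fE (esym (mul1g a))).
rewrite -[LHS]/(u (hitr _ v (hitr _ u (g z)))).
rewrite (hitr_hitr _ _ (esym (mulVg a)) (esym (mulg1 a))).
by rewrite (eq_hitr _ (esym (mulg1 a)) (vuE _)) hitr_eps -fE.
Qed.

Lemma cocleft_of_strong : strong C ->
  (forall a : G, lcomod_isom (comp_lcomod C a) (comp_lcomod C 1%g)) ->
  cocleft C.
Proof.
move=> strC isoC.
have uv a := cid (invertible_of_colinear_iso strC (isoC a)).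
exists (fun a => (sval (uv a)).1); apply/gconv_invertibleP.
exists (fun a => (sval (uv a)).2).
by split=> a; [exact: (svalP (uv a)).1|exact: (svalP (uv a)).2].
Qed.
End CocleftOfStrong.

(** * Crossed coproducts are strong with constant components *)

Section CrossedStrong.
Variables (k : fieldType) (G : groupType).

Lemma gcoalg_hom_dl (C D : gcoalg k G) (phi : gcoalg_hom C D) a b t
    (h : t = (a * b)%g) x :
  gdl h (phi t x) = tmap (phi a) (phi b) (gdl h x).
Proof. by subst t; rewrite /= gcoalg_map_delta. Qed.

Section Crossed.
Variables (D : coalg k) (lam : G -> {linear D -> D}).
Variables (f g : G -> G -> {scalar D}).
Variables (lamP : weak_action lam) (fP : factor_set lam f g).

(** The left inverse of the comultiplication is
    [x (x) y |-> x_(1) g_(a,b)(x_(2)) eps(y)], because [eps o lam_a = eps]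
    turns [c_(1) (x) lam_a(c_(2)) f_(a,b)(c_(3))] into
    [c_(1) g_(a,b)(c_(2)) f_(a,b)(c_(3)) = c]. *)
Lemma crossed_strong : strong (crossed_gcoalg lamP fP).
Proof.
move=> a b; apply: (can_inj (g := fun t => sweedler t (fun x y =>
  ceps D y *: sweedler (cdelta D x) (fun p q => g a b q *: p)))).
move=> c /=; rewrite crossed_deltaE.
rewrite (sweedler_tmap (U := D) (V := D)); last first.
  split=> [y e x x'|x e y y']; last by rewrite linearP scalerDl scalerA.
  rewrite linearP sweedler_linear; last by bilin_tac.
  by rewrite scalerDr !scalerA mulrC.
have epsf y : ceps D (crossed_twist lam f a b y) = f a b y.
  rewrite /crossed_twist sweedler_scalar -[in RHS](cepsl y) sweedler_scalar.
  by apply: eq_sweedler => p q; rewrite !linearZ /= (lamP a).2 mulrC.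
transitivity (sweedler3 c (fun p q y => (g a b q * f a b y) *: p)).
  rewrite -sweedlerA; try by [move=> ?; bilin_tac|lin_tac].
  apply: eq_sweedler => x y; rewrite epsf sweedler_scaler.
  by apply: eq_sweedler => p q; rewrite scalerA mulrC.
rewrite -[RHS]cepsr; apply: eq_sweedler => p y.
by rewrite -sweedler_scalel -((fs_inv fP a b).2 y).
Qed.

(** The coaction involves only [lam 1] and [f 1 a], and [f 1 a = f 1 1]. *)
Lemma crossed_ucoact a b (x : D) :
  gdl (C := crossed_gcoalg lamP fP) (esym (mul1g a)) x =
  gdl (C := crossed_gcoalg lamP fP) (esym (mul1g b)) x.
Proof.
rewrite /gdl /= !gcast_const; apply: eq_sweedler => y z.
by apply: eq_sweedler => p q; rewrite !(fs_f1l fP).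
Qed.
End Crossed.

(** The colinear isomorphism is the identity of the underlying space of the
    crossed coproduct, conjugated by the given isomorphism. *)
Lemma strong_of_crossed (C : gcoalg k G) (D : coalg k)
    (lam : G -> {linear D -> D}) (f g : G -> G -> {scalar D})
    (lamP : weak_action lam) (fP : factor_set lam f g) :
  gcoalg_isom C (crossed_gcoalg lamP fP) -> strong C /\
    forall a : G, lcomod_isom (comp_lcomod C a) (comp_lcomod C 1%g).
Proof.
case=> phi [psi [phiK psiK]]; split=> [a b x y xy|].
  apply/(can_inj (phiK _))/(@crossed_strong _ _ _ _ lamP fP).
  by rewrite -!gcoalg_map_delta xy.
have hom a b : exists h : lcomod_hom (comp_lcomod C a) (comp_lcomod C b),
    forall x, h x = psi b (phi a x).
  have colin x : gdl (esym (mul1g b)) (psi b (phi a x)) =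
      tmap idfun (psi b \o phi a) (gdl (esym (mul1g a)) x).
    rewrite (gcoalg_hom_dl psi (esym (mul1g b))) (crossed_ucoact lamP fP b a).
    rewrite (gcoalg_hom_dl phi (esym (mul1g a))) tmap_tmap.
    by apply: eq_tmap => // y /=; rewrite phiK.
  by exists (@LComodHom k (unit_coalg C) (comp_lcomod C a) (comp_lcomod C b)
                        (psi b \o phi a) colin).
move=> a; have [h hE] := hom a 1%g; have [h' hE'] := hom 1%g a.
by exists h, h'; split=> x; rewrite hE hE' psiK phiK.
Qed.
End CrossedStrong.

(** * The crossed coproduct of a normalized cleft family *)

Lemma gcoalg_isom_of_bij (k : fieldType) (G : groupType) (C D : gcoalg k G)
    (phi : gcoalg_hom C D) (psi : forall a, {linear D a -> C a}) :
  (forall a, cancel (phi a) (psi a)) -> (forall a, cancel (psi a) (phi a)) ->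
  gcoalg_isom C D.
Proof.
move=> phiK psiK.
have psi_eps x : geps C (psi 1%g x) = geps D x.
  by rewrite -(gcoalg_map_eps phi) psiK.
have psi_delta a b x : tmap (psi a) (psi b) (gdelta D a b x) =
    gdelta C a b (psi (a * b)%g x).
  rewrite -{1}[x]psiK -gcoalg_map_delta tmap_tmap tmap_id // => y; exact: phiK.
by exists phi, (GCoalgHom psi_eps psi_delta).
Qed.

Section CrossedOfCocleft.
Variables (k : fieldType) (G : groupType) (C : gcoalg k G).
Variables (u : forall a, {scalar C a}) (v : forall a : G, {scalar C a^-1%g}).
Hypothesis uvE : forall a (h : 1%g = (a * a^-1)%g),
  gconv h (u a) (v a) =1 geps C.
Hypothesis vuE : forall a (h : 1%g = (a^-1 * a)%g),
  gconv h (v a) (u a) =1 geps C.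
Hypothesis u1E : u 1%g =1 geps C.
Implicit Types a b c s t : G.

Lemma hitr_uv a s t (h : s = (t * a^-1)%g) (h' : t = (s * a)%g) x :
  hitr h' (u a) (hitr h (v a) x) = x.
Proof.
rewrite (hitr_hitr _ _ (esym (mulgV a)) (esym (mulg1 s))).
by rewrite (eq_hitr _ (esym (mulg1 s)) (uvE _)) hitr_eps.
Qed.

Lemma hitr_vu a s t (h : s = (t * a^-1)%g) (h' : t = (s * a)%g) x :
  hitr h (v a) (hitr h' (u a) x) = x.
Proof.
rewrite (hitr_hitr _ _ (esym (mulVg a)) (esym (mulg1 t))).
by rewrite (eq_hitr _ (esym (mulg1 t)) (vuE _)) hitr_eps.
Qed.

Lemma hitl_vu a s t (h : s = (a^-1 * t)%g) (h' : t = (a * s)%g) x :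
  hitl h' (u a) (hitl h (v a) x) = x.
Proof.
rewrite (hitl_hitl _ _ (esym (mulVg a)) (esym (mul1g s))).
by rewrite (eq_hitl _ (esym (mul1g s)) (vuE _)) hitl_eps.
Qed.

(** Conjugation by [u a] in the dual algebra. *)
Definition cleft_lam a : {linear C 1%g -> C 1%g} :=
  hitl (esym (mulg1 a)) (u a) \o hitr (esym (mulgV a)) (v a).

Definition cleft_f a b : {scalar C 1%g} :=
  gconv (esym (mulgV (a * b)%g)) (gconv erefl (u a) (u b)) (v (a * b)%g).

Definition cleft_g a b : {scalar C 1%g} :=
  gconv (esym (mulgV (a * b)%g)) (u (a * b)%g) (gconv (invgM a b) (v b) (v a)).

(** The actions of [cleft_f] and [cleft_g] are products of three elementary
    actions.  The degree [t] is kept apart from [a * b] so that, for instance,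
    [f a (b * c)] and [f (a * b) c] can be expanded with the same last
    factor. *)
Lemma hitr_f a b s t t1 t2 (h : s = (s * 1)%g) (ht : t = (a * b)%g)
    (h1 : s = (t1 * t^-1)%g) (h2 : t1 = (t2 * b)%g) (h3 : t2 = (s * a)%g) x :
  hitr h (cleft_f a b) x = hitr h3 (u a) (hitr h2 (u b) (hitr h1 (v t) x)).
Proof.
subst t; have e : t1 = (s * (a * b))%g by rewrite h2 h3 mulgA.
by rewrite -(hitr_hitr h1 e) -(hitr_hitr h2 h3).
Qed.

Lemma hitl_f a b s t t1 t2 (h : s = (1 * s)%g) (ht : t = (a * b)%g)
    (h1 : s = (a * t1)%g) (h2 : t1 = (b * t2)%g) (h3 : t2 = (t^-1 * s)%g) x :
  hitl h (cleft_f a b) x = hitl h3 (v t) (hitl h2 (u b) (hitl h1 (u a) x)).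
Proof.
subst t; have e : s = (a * b * t2)%g by rewrite h1 h2 mulgA.
by rewrite (hitl_hitl h1 h2 erefl e) -(hitl_hitl e h3).
Qed.

Lemma hitr_g a b s t t1 t2 (h : s = (s * 1)%g) (ht : t = (a * b)%g)
    (h1 : s = (t1 * a^-1)%g) (h2 : t1 = (t2 * b^-1)%g) (h3 : t2 = (s * t)%g) x :
  hitr h (cleft_g a b) x = hitr h3 (u t) (hitr h2 (v b) (hitr h1 (v a) x)).
Proof.
subst t; have e : s = (t2 * (a * b)^-1)%g by rewrite h3 mulgK.
by rewrite -(hitr_hitr e h3) -(hitr_hitr h1 h2).
Qed.

(** In [lam a c_(1) (x) lam a c_(2)] the factor [v a] of the first conjugation
    and the factor [u a] of the second one are adjacent, hence cancel. *)
Lemma cleft_lam_map a :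
  @is_coalg_map k (unit_coalg C) (unit_coalg C) (cleft_lam a).
Proof.
pose h11 : 1%g = (1 * 1)%g :> G := esym (mul1g 1%g).
split=> c; last first.
  rewrite /= -[LHS]/(geps C (hitl _ _ (hitr _ _ c))) -gconv_hitl.
  rewrite -[LHS]/(u a (hitr _ (geps C) (hitr _ _ c))) hitr_eps.
  exact: uvE.
rewrite -[LHS]/(gdl h11
  (hitl (esym (mulg1 a)) (u a) (hitr (esym (mulgV a)) (v a) c))).
rewrite -[cdelta _ c]/(gdl h11 c).
rewrite (gdl_hitl _ h11 (esym (mulg1 a)) (esym (mulg1 a))).
rewrite (gdl_hitr _ (esym (mulg1 a)) (esym (mul1g a^-1)%g) (esym (mulgV a))).
rewrite tmap_tmap.
have vE : tmap (hitr (esym (mulgV a)) (v a)) idfun (gdl h11 c) =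
    tmap idfun (hitl (esym (mulg1 a^-1)%g) (v a)) (gdl (esym (mulgV a)) c).
  exact: gdl_hit_mid.
transitivity (tmap (hitl (esym (mulg1 a)) (u a))
  (hitr (esym (mul1g a^-1)%g) (v a) \o hitl (esym (mulgV a)) (u a))
  (tmap (hitr (esym (mulgV a)) (v a)) idfun (gdl h11 c))); last first.
  rewrite tmap_tmap; apply: eq_tmap => // y /=.
  by rewrite (hitl_hitr _ _ (esym (mul1g a^-1)%g) (esym (mulgV a))).
rewrite vE tmap_tmap; apply: eq_tmap => // y.
by rewrite -[RHS]/(hitr _ _ (hitl _ _ (hitl _ _ y))) hitl_vu.
Qed.

Lemma cleft_fE a b t (ht : t = (a * b)%g) (h1 : 1%g = (t * t^-1)%g) x :
  cleft_f a b x = u a (hitr ht (u b) (hitr h1 (v t) x)).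
Proof.
rewrite -(eps_hitr _ (esym (mulg1 1%g))).
by rewrite (hitr_f _ ht h1 ht (esym (mul1g a))) eps_hitr.
Qed.

Lemma cleft_f1r a : cleft_f a 1%g =1 geps C.
Proof.
move=> x; rewrite (cleft_fE (esym (mulg1 a)) (esym (mulgV a))).
rewrite (eq_hitr _ (esym (mulg1 a)) u1E) hitr_eps.
by rewrite -(eps_hitr _ (esym (mul1g a))) hitr_uv.
Qed.

Lemma cleft_f1l a : cleft_f 1%g a =1 geps C.
Proof.
move=> x; rewrite (cleft_fE (esym (mul1g a)) (esym (mulgV a))).
by rewrite u1E hitr_uv.
Qed.

Lemma convE (p q : {scalar C 1%g}) (h : 1%g = (1 * 1)%g) x :
  @conv k (unit_coalg C) p q x = p (hitr h q x).
Proof.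
rewrite -[RHS]/(gconv h p q x) gconvE (eq_irrelevance h (esym (mul1g 1%g))).
by [].
Qed.

Lemma cleft_fg a b (h : 1%g = (1 * 1)%g) x :
  cleft_f a b (hitr h (cleft_g a b) x) = geps C x.
Proof.
have h1 : a = (a * b * b^-1)%g by rewrite mulgK.
rewrite (hitr_g _ erefl (esym (mulgV a)) h1 (esym (mul1g _))).
rewrite (cleft_fE erefl (esym (mulgV _))) hitr_vu.
by rewrite hitr_uv -(eps_hitr _ (esym (mul1g a))) hitr_uv.
Qed.

Lemma cleft_gf a b (h : 1%g = (1 * 1)%g) x :
  cleft_g a b (hitr h (cleft_f a b) x) = geps C x.
Proof.
have h1 : a = (a * b * b^-1)%g by rewrite mulgK.
rewrite (hitr_f _ erefl (esym (mulgV _)) erefl (esym (mul1g a))).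
rewrite -(eps_hitr _ h) (hitr_g _ erefl (esym (mulgV a)) h1 (esym (mul1g _))).
by rewrite !hitr_vu hitr_uv.
Qed.

Lemma cleft_g11 : cleft_g 1%g 1%g =1 geps C.
Proof.
move=> x; rewrite -(cleft_fg 1%g 1%g (esym (mul1g 1%g))).
by rewrite cleft_f1r eps_hitr.
Qed.

Lemma cleft_lam1 x : cleft_lam 1%g x = x.
Proof.
rewrite -[LHS]/(hitl _ _ (hitr _ _ x)).
rewrite (eq_hitl _ (esym (mul1g 1%g)) u1E) hitl_eps.
rewrite -[LHS](hitr_eps (esym (mulg1 _))) -(eq_hitr (esym (mulg1 _)) _ u1E).
by rewrite hitr_uv.
Qed.

(** Both sides reduce to [u a * u b * u c * v (a b c)]. *)
Lemma cleft_cocycle a b c (h : 1%g = (1 * 1)%g) x :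
  cleft_f b c (cleft_lam a (hitr h (cleft_f a (b * c)%g) x)) =
  cleft_f a b (hitr h (cleft_f (a * b)%g c) x).
Proof.
pose t := (a * b * c)%g; pose h1 : 1%g = (t * t^-1)%g := esym (mulgV t).
have ht : t = (a * (b * c))%g := esym (mulgA a b c).
have h2 : a = (t * (b * c)^-1)%g by rewrite ht mulgK.
rewrite (hitr_f _ ht h1 ht (esym (mul1g a))).
rewrite (hitr_f _ erefl h1 erefl (esym (mul1g (a * b)%g))).
rewrite (cleft_fE erefl (esym (mulgV (a * b)%g))) hitr_vu.
rewrite -[cleft_lam a _]/(hitl _ _ (hitr _ _ _)) hitr_vu.
rewrite -(gconv_hitl (esym (mulg1 a))) -[LHS]/(u a (hitr _ _ _)).
by rewrite (hitr_f _ erefl h2 erefl erefl) hitr_vu.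
Qed.

(** Both sides reduce to [u a * u b * _ * v (a b)]: the cocycle contributes
    [v (a b)] on the left-hand side and [u a * u b] on the right-hand side. *)
Lemma cleft_twist a b (h : 1%g = (1 * 1)%g) x :
  cleft_lam b (cleft_lam a (hitr h (cleft_f a b) x)) =
  cleft_lam (a * b)%g (hitl h (cleft_f a b) x).
Proof.
rewrite -![cleft_lam _ _]/(hitl _ _ (hitr _ _ _)).
rewrite (hitr_f _ erefl (esym (mulgV _)) erefl (esym (mul1g a))) hitr_vu.
rewrite (hitl_hitr erefl _ (esym (mul1g b)) erefl) hitr_vu.
rewrite -[in RHS](hitl_hitr (esym (mulgV (a * b)%g)) (esym (mul1g (a * b)%g))).
rewrite (hitl_f _ erefl erefl (esym (mulg1 b)) (esym (mulVg (a * b)%g))).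
by rewrite hitl_vu.
Qed.

Lemma cleft_weak_action : @weak_action k G (unit_coalg C) cleft_lam.
Proof. exact: cleft_lam_map. Qed.

Lemma cleft_factor_set :
  @factor_set k G (unit_coalg C) cleft_lam cleft_f cleft_g.
Proof.
have h : 1%g = (1 * 1)%g :> G := esym (mul1g 1%g).
split.
- by move=> a b; split=> c; rewrite (convE _ _ h) ?cleft_fg ?cleft_gf.
- move=> c; rewrite cleft_lam1 -[LHS](@cepsl k (unit_coalg C) c).
  apply: eq_sweedler => x y.
  rewrite -[in LHS](@cepsr k (unit_coalg C) y) sweedler_scaler.
  by apply: eq_sweedler => p q; rewrite scalerA cleft_f1l cleft_g11.
- by move=> a c; rewrite !cleft_f1l.
- by move=> a c; rewrite cleft_f1r cleft_f1l (cleft_lam_map a).2.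
- move=> a b c x.
  rewrite -[LHS]/(@conv k (unit_coalg C)
    (cleft_f b c \o cleft_lam a) (cleft_f a (b * c)%g) x).
  rewrite -[RHS]/(@conv k (unit_coalg C) (cleft_f a b) (cleft_f (a * b)%g c) x).
  rewrite !(convE _ _ h); exact: cleft_cocycle.
- move=> a b x.
  have lamr :=
    linear_contr_r (cleft_lam b \o cleft_lam a) (cleft_f a b) (udelta C x).
  have laml := linear_contr_l (cleft_lam (a * b)%g) (cleft_f a b) (udelta C x).
  have := cleft_twist a b (esym (mul1g 1%g)) x.
  by move=> twist; exact: etrans (esym lamr) (etrans twist laml).
Qed.

(** On [hitr (u (a * b)) y] the twist [lam a] times [f a b] loses the pairs
    [v a, u a] and [v (a * b), u (a * b)]; what remains, [u a] acting from the
    left and [u b] from the right, is what the two bijections produce after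
    the middle [u a] is moved across the tensor sign. *)
Lemma gdl_cleft a b x :
  tmap (hitr (esym (mul1g a)) (u a)) (hitr (esym (mul1g b)) (u b))
    (gdl (erefl (a * b)%g) x) =
  crossed_delta (C := unit_coalg C) cleft_lam cleft_f a b
    (hitr (esym (mul1g (a * b)%g)) (u (a * b)%g) x).
Proof.
pose h : 1%g = (1 * 1)%g :> G := esym (mul1g 1%g).
pose ab1 := esym (mul1g (a * b)%g).
rewrite crossed_deltaE -[cdelta _ _]/(gdl h (hitr ab1 _ x)).
rewrite (gdl_hitr _ h ab1 ab1) [RHS]tmap_tmap.
transitivity (tmap idfun (hitr (esym (mul1g b)) (u b))
  (tmap (hitr (esym (mul1g a)) (u a)) idfun (gdl (erefl (a * b)%g) x))).
  by rewrite tmap_tmap.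
rewrite (gdl_hit_mid _ (erefl (a * b)%g) _ ab1) tmap_tmap.
apply: eq_tmap => // y.
have twistE z : crossed_twist (C := unit_coalg C) cleft_lam cleft_f a b z =
    cleft_lam a (hitr h (cleft_f a b) z).
  by rewrite /hitr linear_contr_r.
rewrite -[RHS]/(crossed_twist (C := unit_coalg C) cleft_lam cleft_f a b
  (hitr ab1 _ y)) twistE.
rewrite (hitr_f _ erefl (esym (mulgV _)) erefl (esym (mul1g a))) hitr_vu.
rewrite -[RHS]/(hitl _ _ (hitr _ _ _)) hitr_vu.
by rewrite (hitl_hitr _ _ (esym (mul1g b)) erefl).
Qed.

Lemma cleft_isom :
  gcoalg_isom C (crossed_gcoalg cleft_weak_action cleft_factor_set).
Proof.
pose phi a : {linear C a -> C 1%g} := hitr (esym (mul1g a)) (u a).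
have phi_eps x : cleft_g 1%g 1%g (phi 1%g x) = geps C x.
  rewrite cleft_g11 /phi /= eps_hitr; exact: u1E.
have phi_delta a b x : tmap (phi a) (phi b) (gdelta C a b x) =
    crossed_delta (C := unit_coalg C) cleft_lam cleft_f a b (phi (a * b)%g x).
  exact: gdl_cleft.
pose X := crossed_gcoalg cleft_weak_action cleft_factor_set.
pose hom : gcoalg_hom C X := @GCoalgHom k G C X phi phi_eps phi_delta.
pose psi a : {linear C 1%g -> C a} := hitr (esym (mulgV a)) (v a).
have homK a : cancel (hom a) (psi a) by move=> x; exact: hitr_vu.
have psiK a : cancel (psi a) (hom a) by move=> x; exact: hitr_uv.
exact (@gcoalg_isom_of_bij k G C X hom psi homK psiK).
Qed.

Lemma cleft_normalized : @normalized k G (unit_coalg C) cleft_f.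
Proof. by move=> a x; rewrite cleft_f1r cleft_f1l. Qed.

End CrossedOfCocleft.

Lemma crossed_of_cocleft (k : fieldType) (G : groupType) (C : gcoalg k G) :
  cocleft C ->
  exists (D : coalg k) (lam : G -> {linear D -> D}) (f g : G -> G -> {scalar D})
      (lamP : weak_action lam) (fP : factor_set lam f g),
    normalized f /\ gcoalg_isom C (crossed_gcoalg lamP fP).
Proof.
move=> [u /gconv_invertibleP[v [uvE vuE]]].
have h1 (a : G) : a = (1^-1 * a)%g by rewrite invg1 mul1g.
(* [u' 1 = v 1 * u 1 = eps], and multiplying by the invertible element [v 1] of
   degree one preserves invertibility. *)
pose u' a : {scalar C a} := gconv (h1 a) (v 1%g) (u a).
pose v' a : {scalar C a^-1%g} := gconv (esym (mulg1 a^-1%g)) (v a) (u 1%g).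
have u1E : u' 1%g =1 geps C by exact: vuE.
have uvE' a (h : 1%g = (a * a^-1)%g) : gconv h (u' a) (v' a) =1 geps C.
  move=> x; rewrite -[LHS]/(v 1%g (hitr (h1 a) (u a) (hitr h (v' a) x))).
  have h2 : 1^-1%g = (a * a^-1)%g by rewrite invg1 mulgV.
  rewrite -(hitr_hitr (h1 1%g) h2) (hitr_uv uvE); exact: vuE.
have vuE' a (h : 1%g = (a^-1 * a)%g) : gconv h (v' a) (u' a) =1 geps C.
  move=> x; rewrite -[LHS]/(v a (hitr _ (u 1%g) (hitr h (u' a) x))).
  have h2 : a^-1%g = (a^-1 * 1^-1)%g by rewrite invg1 mulg1.
  rewrite -(hitr_hitr h h2) (hitr_uv uvE); exact: vuE.
exists (unit_coalg C), (cleft_lam u' v'), (cleft_f u' v'), (cleft_g u' v').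
exists (cleft_weak_action uvE' vuE'), (cleft_factor_set uvE' vuE' u1E).
split; [exact: cleft_normalized|exact: cleft_isom].
Qed.

(** * The equivalence *)

Theorem theorem3p4 (k : fieldType) (G : groupType) (C : gcoalg k G) :
  [<-> cocleft C;
       exists (D : coalg k) (lam : G -> {linear D -> D})
              (f g : G -> G -> {scalar D})
              (lamP : weak_action lam) (fP : factor_set lam f g),
         gcoalg_isom C (crossed_gcoalg lamP fP);
       exists (D : coalg k) (lam : G -> {linear D -> D})
              (f g : G -> G -> {scalar D})
              (lamP : weak_action lam) (fP : factor_set lam f g),
         normalized f /\ gcoalg_isom C (crossed_gcoalg lamP fP);
       strong C /\
         forall a : G, lcomod_isom (comp_lcomod C a) (comp_lcomod C 1%g)].
Proof.
tfae.
- move=> /crossed_of_cocleft[D [lam [f [g [lamP [fP [_ isoC]]]]]]].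
  by exists D, lam, f, g, lamP, fP.
- move=> [D [lam [f [g [lamP [fP /strong_of_crossed[strC isoC]]]]]]].
  exact/crossed_of_cocleft/cocleft_of_strong.
- by move=> [D [lam [f [g [lamP [fP [_ /strong_of_crossed]]]]]]].
- by move=> [strC isoC]; exact: cocleft_of_strong.
Qed.
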